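(* Let $D$ be a third almost-regular hypergraph degree sequence and let $H_1$ and $H_2$ be two hypergraph realizations of $D$. Then there exists a finite series of switch operations that transforms $H_1$ into $H_2$.
   Context: A partite $3$-uniform hypergraph (here simply: hypergraph) $H=(A,B,C,E)$ has a finite vertex set that is the disjoint union of three vertex classes $A,B,C$, and a set $E$ of hyperedges, each containing exactly one vertex of each class; thus $E$ can be identified with a subset of $A\times B\times C$. The degree of a vertex is the number of hyperedges containing it. A hypergraph degree sequence $D=(D_A,D_B,D_C)$ assigns a non-negative integer to each vertex of $A$, $B$, $C$; $H$ on the vertex classes $A,B,C$ is a realization of $D$ if every vertex has its prescribed degree. All realizations of $D$ are considered on the same (labelled) vertex classes $A,B,C$. $D$ is third almost-regular if there is an integer $k$ such that every degree in $D_A$ is $k$ or $k-1$ (no restriction on $D_B$, $D_C$). A switch operation on $H$ removes two hyperedges $(a_1,b_1,c_1),(a_2,b_2,c_2)\in E$ and creates the two new hyperedges $(a_2,b_1,c_1),(a_1,b_2,c_2)$, where it is required that neither of the two new hyperedges is in $E$ before the operation. Switch operations swapping the vertices in class $B$ (creating $(a_1,b_2,c_1),(a_2,b_1,c_2)$) or in class $C$ (creating $(a_1,b_1,c_2),(a_2,b_2,c_1)$) are defined similarly. *)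

(* Defs.v *)
From mathcomp Require Import all_boot all_order all_algebra.
Set Implicit Arguments.
Unset Strict Implicit.
Unset Printing Implicit Defensive.

(* A hypergraph on the labelled vertex classes A, B, C is its edge set;
   the triple (a, b, c) parses as ((a, b), c). *)
Definition hypergraph (A B C : finType) := {set A * B * C}.

Record degree_sequence (A B C : finType) := DegreeSequence {
  D_A : A -> nat;
  D_B : B -> nat;
  D_C : C -> nat }.

Section Hypergraphs.
Variables A B C : finType.
Implicit Types (H : hypergraph A B C) (D : degree_sequence A B C).
Implicit Types e : A * B * C.

Definition deg_A H (a : A) : nat := #|[set e in H | e.1.1 == a]|.
Definition deg_B H (b : B) : nat := #|[set e in H | e.1.2 == b]|.
Definition deg_C H (c : C) : nat := #|[set e in H | e.2 == c]|.

Definition realization D H : Prop :=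
  [/\ forall a, deg_A H a = D_A D a,
      forall b, deg_B H b = D_B D b
    & forall c, deg_C H c = D_C D c].

(* The subtraction k - 1 is in int, so it is not truncated. *)
Definition third_almost_regular D : Prop :=
  exists k : int, forall a : A,
    Posz (D_A D a) = k \/ Posz (D_A D a) = (k - 1)%R.

(* e1 with its vertex in the given class replaced by that of e2. *)
Definition swap_A e1 e2 : A * B * C := (e2.1.1, e1.1.2, e1.2).
Definition swap_B e1 e2 : A * B * C := (e1.1.1, e2.1.2, e1.2).
Definition swap_C e1 e2 : A * B * C := (e1.1.1, e1.1.2, e2.2).

(* Since the new hyperedges are not in H, e1 and e2 differ in the swapped
   class and in at least one other class; in particular all four hyperedges
   are distinct. *)
Definition switch_by (swap : A * B * C -> A * B * C -> A * B * C)
    : rel (hypergraph A B C) := fun H H' =>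
  [exists e1 in H, exists e2 in H,
    [&& swap e1 e2 \notin H, swap e2 e1 \notin H
      & H' == (H :\: [set e1; e2]) :|: [set swap e1 e2; swap e2 e1]]].

Definition switch : rel (hypergraph A B C) := fun H H' =>
  [|| switch_by swap_A H H', switch_by swap_B H H' | switch_by swap_C H H'].

End Hypergraphs.

(* Main.v *)
(* Project a hypergraph to the matrix of codegrees, indexed by B x C and bounded by |A|.
   Two different bounded nonnegative matrices with the same margins are brought
   closer, in l^1 distance, by an elementary 2x2 move on one of them.  For 0/1
   matrices on A x (B x C), such moves are A-switches, so hypergraphs with the
   same A-degrees and the same codegrees are connected.  For the codegree
   matrices, a move on the cells (b1, c1), (b2, c1), (b2, c2), (b1, c2) is one
   B-switch as soon as some vertex of A is adjacent to (b1, c1) but not to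
   (b2, c1), and some vertex to (b2, c2) but not to (b1, c2).  As the A-degrees
   differ by at most one, this can be arranged by A-switches: if every vertex
   adjacent to (b2, c2) is adjacent to (b1, c2), take one vertex adjacent to both
   and one adjacent to neither; the latter must have another neighbour to trade. *)
Require Import Defs.
From mathcomp Require Import all_boot all_order all_algebra.
From mathcomp Require Import perm zify.
Set Implicit Arguments.
Unset Strict Implicit.
Unset Printing Implicit Defensive.

(** * Natural-number matrices with equal margins *)

Lemma eq_sum_exists_gt (T : finType) (f g : T -> nat) (x : T) :
  \sum_y f y = \sum_y g y -> f x < g x -> exists y, g y < f y.
Proof.
move=> eq_fg lt_x; apply/existsP; apply: contraLR lt_x => /existsPn le_fg.
have le_sum : \sum_(y | y != x) f y <= \sum_(y | y != x) g y.
  by apply: leq_sum => y _; rewrite leqNgt le_fg.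
by move: eq_fg; rewrite (bigD1 x) //= [RHS](bigD1 x) //=; lia.
Qed.

(** A closed alternating cycle may need more than four cells, so only three of the four comparisons
    are strict. This is enough for a 2x2 move to reduce the distance. *)
Lemma alternating_path (X Y : finType) (M N : X -> Y -> nat) x0 y0 :
    (forall x, \sum_y M x y = \sum_y N x y) ->
    (forall y, \sum_x M x y = \sum_x N x y) ->
    M x0 y0 != N x0 y0 ->
  exists x1 x2 y1 y2, [/\ N x1 y1 < M x1 y1, M x2 y1 < N x2 y1,
    N x2 y2 < M x2 y2 & M x1 y2 <= N x1 y2].
Proof.
move=> eq_row eq_col neq0; pose P x := [set y | N x y < M x y].
have [x [y Pxy]] : exists x y, y \in P x.
  move: neq0; rewrite neq_ltn => /orP[lt0 | lt0]; last first.
    by exists x0, y0; rewrite inE.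
  by have [y lty] := eq_sum_exists_gt (eq_row x0) lt0; exists x0, y; rewrite inE.
have Px : P x != set0 by apply/set0Pn; exists y.
(* Along [N x1 y1 < M x1 y1], [M x2 y1 < N x2 y1] the nonempty set [P x1] cannot
   contain [P x2] if it is of minimal cardinal. *)
case: (@arg_minnP _ x (fun x => P x != set0)
           (fun x => #|P x|) Px) => x1 /set0Pn[y1 Py1] min_x1.
have lt1 : N x1 y1 < M x1 y1 by move: Py1; rewrite inE.
have [x2 lt2] := eq_sum_exists_gt (esym (eq_col y1)) lt1.
have [y3 lt3] := eq_sum_exists_gt (eq_row x2) lt2.
have : ~~ (P x2 \proper P x1).
  apply/negP => /proper_card; rewrite ltnNge min_x1 //.
  by apply/set0Pn; exists y3; rewrite inE.
rewrite properE negb_and negbK => /orP[/subsetPn[y2] | /subsetP/(_ _ Py1)].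
  by rewrite !inE -leqNgt => lt22 le12; exists x1, x2, y1, y2.
by rewrite inE ltnNge (ltnW lt2).
Qed.

Lemma sum_eq1 (T : finType) (x : T) : \sum_y (y == x : nat) = 1.
Proof. by rewrite (bigD1 x) //= eqxx big1 // => y /negPf->. Qed.

(* Half the l^1 distance of matrices with equal sums; one takes [N' = N] to move
   [M], and [M' = M] to move [N] in the opposite direction. *)
Lemma exchange_dist (T : finType) (M N M' N' : T -> nat) p q r s :
    p != r -> N p < M p -> M q < N q -> N r < M r -> M s <= N s ->
    (forall z, M' z + N z + (z == p) + (z == r)
             = M z + N' z + (z == q) + (z == s)) ->
  \sum_z (M' z - N' z) < \sum_z (M z - N z).
Proof.
move=> npr lp lq lr ls E.
(* The positive part of the difference drops by one at [p] and at [r], stays zero at [q], and grows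
   by at most one at [s]: a net loss of at least one. *)
suff : \sum_z (M' z - N' z + (z == p) + (z == r)) <=
       \sum_z (M z - N z + (z == s)).
  by rewrite !big_split /= !sum_eq1; lia.
apply: leq_sum => z _; move: (E z).
have zp : z == p -> N z < M z by move=> /eqP->.
have zq : z == q -> M z < N z by move=> /eqP->.
have zr : z == r -> N z < M z by move=> /eqP->.
have zs : z == s -> M z <= N z by move=> /eqP->.
have zpr : ~~ ((z == p) && (z == r)) by apply: contra npr => /andP[/eqP<-].
by lia.
Qed.

(** The maps [g], [h], [f] split [T] as a product. Splitting off [A] or [B * C] gives row and column
    sums of the same 0/1 matrix. *)
Lemma card_fiber (X Y T : finType) (g : X -> Y -> T) (h : T -> X) (f : T -> Y)
    (H : {set T}) (y : Y) :
    (forall e, g (h e) (f e) = e) -> (forall x y, h (g x y) = x) ->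
    (forall x y, f (g x y) = y) ->
  #|[set e in H | f e == y]| = \sum_x (g x y \in H : nat).
Proof.
move=> gK hK fK; transitivity #|[set x | g x y \in H]|; last first.
  by rewrite -sum1dep_card big_mkcond; apply: eq_bigr => x _; case: (_ \in _).
rewrite -(card_imset _ (can_inj (fun x => hK x y))); apply: eq_card => e.
rewrite !inE; apply/andP/imsetP => [[eH /eqP<-] | [x]].
  by exists (h e); rewrite ?inE gK.
by rewrite inE => gH ->; rewrite fK.
Qed.

(** * Switches as exchanges of hyperedges *)

Section Switches.
Variables A B C : finType.
Implicit Types (H : hypergraph A B C) (D : degree_sequence A B C).
Implicit Types (e : A * B * C) (swap : A * B * C -> A * B * C -> A * B * C).

(** Removed edges are added back on the left, which avoids truncated subtraction; summing over any
    class of edges then gives the change of its degree. *)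
Definition exchange H H' e1 e2 f1 f2 := forall e,
  (e \in H') + (e == e1) + (e == e2) = (e \in H) + (e == f1) + (e == f2).

(** The first law forces the two switched edges to be distinct; the second lets the created edges be
    switched back. *)
Definition involutive_swap swap :=
  (forall e, swap e e = e) /\
  (forall e1 e2, swap (swap e1 e2) (swap e2 e1) = e1).

Lemma swap_A_inv : involutive_swap (@swap_A A B C).
Proof. by split=> [|] [[? ?] ?] // [[? ?] ?]. Qed.

Lemma swap_B_inv : involutive_swap (@swap_B A B C).
Proof. by split=> [|] [[? ?] ?] // [[? ?] ?]. Qed.

Lemma swap_C_inv : involutive_swap (@swap_C A B C).
Proof. by split=> [|] [[? ?] ?] // [[? ?] ?]. Qed.

Lemma switch_by_exchange swap H e1 e2 : involutive_swap swap ->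
    e1 \in H -> e2 \in H -> swap e1 e2 \notin H -> swap e2 e1 \notin H ->
  exists2 H', switch_by swap H H' &
    exchange H H' e1 e2 (swap e1 e2) (swap e2 e1).
Proof.
move=> [swap_id swapK] e1H e2H f1H f2H.
exists ((H :\: [set e1; e2]) :|: [set swap e1 e2; swap e2 e1]).
  apply/exists_inP; exists e1 => //; apply/exists_inP; exists e2 => //.
  by rewrite f1H f2H eqxx.
have ne : e1 != e2 by apply: contraNneq f1H => <-; rewrite swap_id.
have nf : swap e1 e2 != swap e2 e1.
  by apply: contraNneq f1H => f12; rewrite f12 -(swap_id (swap e2 e1)) -{1}f12 swapK.
move=> e; rewrite !inE.
have [->|_] := eqVneq e e1.
  by rewrite (negPf ne) e1H (negPf (memPn f1H _ e1H)) (negPf (memPn f2H _ e1H)).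
have [->|_] := eqVneq e e2.
  by rewrite e2H (negPf (memPn f1H _ e2H)) (negPf (memPn f2H _ e2H)).
have [->|_] := eqVneq e (swap e1 e2); first by rewrite (negPf f1H) (negPf nf).
by have [->|_] := eqVneq e (swap e2 e1); rewrite /= ?(negPf f2H) ?addn0 ?orbF.
Qed.

Lemma switch_by_sym swap : involutive_swap swap -> symmetric (switch_by swap).
Proof.
move=> swapP; suff imp H H' : switch_by swap H H' -> switch_by swap H' H.
  by move=> H H'; apply/idP/idP; apply: imp.
have [swap_id swapK] := swapP.
move=> /exists_inP[e1 e1H] /exists_inP[e2 e2H] /and3P[f1H f2H /eqP->].
apply/exists_inP; exists (swap e1 e2); first by rewrite !inE eqxx orbT.
apply/exists_inP; exists (swap e2 e1); first by rewrite !inE eqxx !orbT.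
have ne1 : (e1 == swap e1 e2 = false) * (e1 == swap e2 e1 = false).
  by split; apply/negbTE; [move: f1H | move: f2H]; apply: contraNneq => <-.
have ne2 : (e2 == swap e1 e2 = false) * (e2 == swap e2 e1 = false).
  by split; apply/negbTE; [move: f1H | move: f2H]; apply: contraNneq => <-.
rewrite !swapK !inE !eqxx !ne1 !ne2 orbT /=; apply/eqP/setP=> e; rewrite !inE.
have [->|_] := eqVneq e e1; first by rewrite e1H !ne1.
have [->|_] := eqVneq e e2; first by rewrite e2H !ne2.
have [->|_] := eqVneq e (swap e1 e2); first by rewrite (negPf f1H).
have [->|_] := eqVneq e (swap e2 e1); first by rewrite (negPf f2H).
by rewrite !orbF.
Qed.

Lemma switch_sym : symmetric (@switch A B C).
Proof.
move=> H H'; rewrite /switch (switch_by_sym swap_A_inv).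
by rewrite (switch_by_sym swap_B_inv) (switch_by_sym swap_C_inv).
Qed.

Lemma card_exchange H H' e1 e2 f1 f2 (P : pred (A * B * C)) :
  exchange H H' e1 e2 f1 f2 ->
  #|[set e in H' | P e]| + P e1 + P e2 = #|[set e in H | P e]| + P f1 + P f2.
Proof.
move=> exH.
have cardP (G : {set A * B * C}) : #|[set e in G | P e]| = \sum_e (e \in G) * P e.
  rewrite -sum1_card big_mkcond; apply: eq_bigr => e _.
  by rewrite !inE; case: (e \in G) (P e) => [] [].
have valP e' : P e' = \sum_e (e == e') * P e :> nat.
  by rewrite (bigD1 e') //= eqxx mul1n big1 ?addn0 // => e /negPf->.
rewrite !cardP (valP e1) (valP e2) (valP f1) (valP f2) -!big_split /=.
by apply: eq_bigr => e _; rewrite -!mulnDl exH.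
Qed.

(** * Codegrees, and hypergraphs sharing them *)

Definition codeg H (y : B * C) := #|[set e in H | (e.1.2, e.2) == y]|.

Lemma deg_A_sum H a : deg_A H a = \sum_(y : B * C) ((a, y.1, y.2) \in H : nat).
Proof.
by apply: (@card_fiber _ _ _ (fun (y : B * C) a => (a, y.1, y.2))
           (fun e => (e.1.2, e.2))) => [[[]] | []|].
Qed.

Lemma codeg_sum H y : codeg H y = \sum_(a : A) ((a, y.1, y.2) \in H : nat).
Proof.
by apply: (@card_fiber _ _ _ (fun a (y : B * C) => (a, y.1, y.2))
           (fun e => e.1.1)) => [[[]] | |? []].
Qed.

Lemma deg_B_sum H b : deg_B H b = \sum_(c : C) codeg H (b, c).
Proof.
rewrite /deg_B -sum1_card (partition_big (fun e => e.2) predT) //=.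
apply: eq_bigr => c _; rewrite sum1dep_card; apply: eq_card => e.
by rewrite !inE xpair_eqE andbA.
Qed.

Lemma deg_C_sum H c : deg_C H c = \sum_(b : B) codeg H (b, c).
Proof.
rewrite /deg_C -sum1_card (partition_big (fun e => e.1.2) predT) //=.
apply: eq_bigr => b _; rewrite sum1dep_card; apply: eq_card => e.
by rewrite !inE xpair_eqE -andbA [(_ == c) && _]andbC.
Qed.

Lemma edge_pair_eq (a a' : A) (y y' : B * C) :
  ((a, y.1, y.2) == (a', y'.1, y'.2) :> A * B * C) = (a == a') && (y == y').
Proof. by case: y y' => [b c] [b' c']; rewrite !xpair_eqE andbA. Qed.

(** In each of the columns [y1] and [y2] exactly one of [a1], [a2] has an edge, so the switch
    amounts to transposing these two rows there. The exchange form serves distances, the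
    transposition form serves neighbourhoods. *)
Lemma switch_A_step H a1 a2 (y1 y2 : B * C) :
    (a1, y1.1, y1.2) \in H -> (a2, y2.1, y2.2) \in H ->
    (a2, y1.1, y1.2) \notin H -> (a1, y2.1, y2.2) \notin H ->
  exists H', [/\ switch H H', deg_A H' =1 deg_A H, codeg H' =1 codeg H,
    exchange H H' (a1, y1.1, y1.2) (a2, y2.1, y2.2)
                  (a2, y1.1, y1.2) (a1, y2.1, y2.2)
  & forall d z, ((d, z.1, z.2) \in H') =
      ((if z \in [:: y1; y2] then tperm a1 a2 d else d, z.1, z.2) \in H)].
Proof.
move=> e1H e2H f1H f2H.
have [H' sw ex] := switch_by_exchange swap_A_inv e1H e2H f1H f2H.
exists H'; split=> //; first by rewrite /switch sw.
- move=> a; have /= := card_exchange (fun e => e.1.1 == a) ex.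
  by rewrite -!/(deg_A _ a); lia.
- move=> y; have /= := card_exchange (fun e => (e.1.2, e.2) == y) ex.
  by rewrite -!/(codeg _ y); lia.
have na : a1 != a2 by apply: contraNneq f1H => <-.
have ny : y1 != y2 by apply: contraNneq f2H => <-.
move=> d z; have := ex (d, z.1, z.2).
rewrite /swap_A /= !edge_pair_eq !inE.
have [->|_] := eqVneq z y1; rewrite ?(negPf ny) /=.
  case: tpermP => [->|->|n1 n2] /=.
  - by rewrite eqxx (negPf na) e1H (negPf f1H); case: (_ \in _).
  - by rewrite eqxx eq_sym (negPf na) e1H (negPf f1H); case: (_ \in _).
  - by rewrite (introF eqP n1) (introF eqP n2); do 2 case: (_ \in _).
have [->|_] := eqVneq z y2; rewrite ?andbF /=.
  case: tpermP => [->|->|n1 n2] /=.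
  - by rewrite eqxx (negPf na) e2H (negPf f2H); case: (_ \in _).
  - by rewrite eqxx eq_sym (negPf na) e2H (negPf f2H); case: (_ \in _).
  - by rewrite (introF eqP n1) (introF eqP n2); do 2 case: (_ \in _).
by do 2 case: (_ \in _).
Qed.

Lemma connect_codeg H1 H2 :
    deg_A H1 =1 deg_A H2 -> codeg H1 =1 codeg H2 ->
  connect (@switch A B C) H1 H2.
Proof.
have [n] := ubnP (\sum_e ((e \in H1 : nat) - (e \in H2))).
elim: n => // n IHn in H1 H2 *; rewrite ltnS => le_n eqA eqBC.
have [-> // | neqH] := eqVneq H1 H2.
have [a0 [y0 neq0]] : exists a (y : B * C),
    ((a, y.1, y.2) \in H1 : nat) != ((a, y.1, y.2) \in H2).
  move: neqH; rewrite eqEsubset negb_and => /orP[] /subsetPn[[[a b] c] e1 /negPf e2].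
    by exists a, (b, c); rewrite /= e1 e2.
  by exists a, (b, c); rewrite /= e1 e2.
have row a : \sum_(y : B * C) ((a, y.1, y.2) \in H1 : nat)
           = \sum_(y : B * C) ((a, y.1, y.2) \in H2 : nat).
  by rewrite -!deg_A_sum eqA.
have col (y : B * C) : \sum_a ((a, y.1, y.2) \in H1 : nat)
                     = \sum_a ((a, y.1, y.2) \in H2 : nat).
  by rewrite -!codeg_sum eqBC.
have [a1 [a2 [y1 [y2 [lt1 lt2 lt3 le4]]]]] := alternating_path row col neq0.
have na : a1 != a2 by apply: contraTneq lt1 => ->; rewrite -leqNgt ltnW.
have npr : (a1, y1.1, y1.2) != (a2, y2.1, y2.2).
  by rewrite edge_pair_eq (negPf na).
have dist M' N' := @exchange_dist _ (fun e => (e \in H1 : nat))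
  (fun e => (e \in H2 : nat)) M' N' _ _ _ _ npr lt1 lt2 lt3 le4.
move: (lt1) (lt2) (lt3) (le4).
case e1H1: ((a1, y1.1, y1.2) \in H1); case e1H2: ((a1, y1.1, y1.2) \in H2) => // _.
case f1H1: ((a2, y1.1, y1.2) \in H1); case f1H2: ((a2, y1.1, y1.2) \in H2) => // _.
case e2H1: ((a2, y2.1, y2.2) \in H1); case e2H2: ((a2, y2.1, y2.2) \in H2) => // _.
(* The fourth cell decides which side moves: if it is in [H2], the opposite switch applies to [H2];
   otherwise it is in neither hypergraph, and [H1] can be switched. *)
have [f2H2 _ | f2H2] := boolP ((a1, y2.1, y2.2) \in H2).
  have [] := @switch_A_step H2 a2 a1 y1 y2; rewrite ?e1H2 ?e2H2 //.
  move=> H' [sw eqA' eqBC' ex _]; apply: (@connect_trans _ _ H').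
    apply: IHn => [|a|y]; rewrite ?eqA' ?eqBC' ?eqA ?eqBC //.
    apply: leq_trans (dist (fun e => e \in H1 : nat) (fun e => e \in H' : nat) _) le_n.
    by move=> e /=; rewrite -!addnA; congr addn; rewrite !addnA ex.
  by rewrite connect1 // switch_sym.
rewrite leqn0 eqb0 => f2H1.
have [] := @switch_A_step H1 a1 a2 y1 y2; rewrite ?f1H1 //.
move=> H' [sw eqA' eqBC' ex _]; apply: (connect_trans (connect1 sw)).
apply: IHn => [|a|y]; rewrite ?eqA' ?eqBC' ?eqA ?eqBC //.
apply: leq_trans (dist (fun e => e \in H' : nat) (fun e => e \in H2 : nat) _) le_n.
by move=> e /=; rewrite -!(addnAC _ _ (e \in H2 : nat)) ex.
Qed.

(** * Separating cells when the degrees in [A] differ by at most one *)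

Definition balanced H := forall a a', deg_A H a <= (deg_A H a').+1.

Definition link H a := [set y : B * C | (a, y.1, y.2) \in H].

(** The witness [a] is a vertex whose edge over [y] can be moved to [z] by a switch. *)
Definition separated H (y z : B * C) :=
  [exists a : A, ((a, y.1, y.2) \in H) && ((a, z.1, z.2) \notin H)].

Lemma card_link H a : #|link H a| = deg_A H a.
Proof.
rewrite deg_A_sum -sum1dep_card big_mkcond.
by apply: eq_bigr => y _; case: (_ \in _).
Qed.

Lemma codeg_leq H y : codeg H y <= #|A|.
Proof. by rewrite codeg_sum -sum1_card; apply: leq_sum => a _; case: (_ \in _). Qed.

Lemma separatedP H y z :
  reflect (exists2 a, y \in link H a & z \notin link H a) (separated H y z).
Proof.
apply: (iffP existsP) => [[a /andP[ya za]] | [a ya za]]; exists a; rewrite ?inE //.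
by move: ya za; rewrite !inE => -> ->.
Qed.

Lemma not_separated H r s : 0 < codeg H r -> codeg H s < #|A| ->
    ~~ separated H r s ->
  exists a a', [/\ r \in link H a, s \in link H a,
    r \notin link H a' & s \notin link H a'].
Proof.
move=> r_gt0 s_lt /existsPn sep.
have [a ra] : exists a : A, (a, r.1, r.2) \in H.
  apply/existsP; apply: contraLR r_gt0 => /existsPn r0.
  by rewrite codeg_sum big1 // => a _; rewrite (negPf (r0 a)).
have [a' sa'] : exists a : A, (a, s.1, s.2) \notin H.
  apply/existsP; apply: contraLR s_lt => /existsPn s1.
  rewrite -leqNgt codeg_sum -sum1_card leq_sum // => b _.
  by have := s1 b; rewrite negbK => ->.
exists a, a'; rewrite !inE ra sa'.
have := sep a; have := sep a'; rewrite ra sa' andbT => ->; by rewrite negbK.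
Qed.

(** The common part of the two links cancels. A set [U] of two cells thus yields one cell to trade
    back, a set of three yields two. *)
Lemma link_diff H a a' (U : {set B * C}) : balanced H ->
  U \subset link H a :\: link H a' -> #|U| <= #|link H a' :\: link H a|.+1.
Proof.
move=> /(_ a a'); rewrite -!card_link => bal /subset_leq_card/leq_trans; apply.
by rewrite -(leq_add2l #|link H a :&: link H a'|) cardsID addnS setIC cardsID.
Qed.

Lemma link_switch H a a' y x :
    y \in link H a -> y \notin link H a' -> x \in link H a' -> x \notin link H a ->
  exists H', [/\ switch H H', deg_A H' =1 deg_A H, codeg H' =1 codeg H
  & forall d z, (z \in link H' d) =
      (z \in link H (if (z == y) || (z == x) then tperm a a' d else d))].
Proof.
rewrite !inE => ya ya' xa' xa.
have [H' [sw eqA eqBC _ lnk]] := switch_A_step ya xa' ya' xa.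
by exists H'; split=> // d z; rewrite !inE lnk !inE.
Qed.

(** If [a] sees both cells and [a'] neither, balance gives [a'] a private neighbour [x]; trading [r]
    for [x] leaves [a'] with [r] and without [s]. *)
Lemma separate1 H r s : balanced H -> 0 < codeg H r -> codeg H s < #|A| -> r != s ->
  exists H', [/\ connect (@switch A B C) H H', deg_A H' =1 deg_A H,
    codeg H' =1 codeg H & separated H' r s].
Proof.
move=> bal r_gt0 s_lt nrs.
have [sep | nsep] := boolP (separated H r s); first by exists H; rewrite connect0.
have [a [a' [ra sa ra' sa']]] := not_separated r_gt0 s_lt nsep.
have [x] : exists x, x \in link H a' :\: link H a.
  apply/set0Pn; rewrite -card_gt0 -ltnS.
  apply: leq_trans (link_diff (U := [set r; s]) bal _); first by rewrite cards2 nrs.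
  by rewrite subUset !sub1set !in_setD ra sa ra' sa'.
rewrite in_setD => /andP[xa xa'].
have [H' [sw eqA eqBC lnk]] := link_switch ra ra' xa' xa.
exists H'; split=> //; first exact: connect1.
apply/separatedP; exists a'; rewrite lnk ?eqxx ?tpermR //.
by rewrite eq_sym (negPf nrs) (negPf (memPn xa _ sa)).
Qed.

Lemma separate2 H p q r s : balanced H -> 0 < codeg H r -> codeg H s < #|A| ->
    uniq [:: p; q; r; s] -> separated H p q ->
  exists H', [/\ connect (@switch A B C) H H', deg_A H' =1 deg_A H,
    codeg H' =1 codeg H & separated H' p q && separated H' r s].
Proof.
move=> bal r_gt0 s_lt; rewrite /= !inE !negb_or andbT.
move=> /and3P[/and3P[npq npr nps] /andP[nqr nqs] nrs] sep_pq.
have [sep | nsep] := boolP (separated H r s).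
  by exists H; rewrite connect0 sep_pq.
have [a [a' [ra sa ra' sa']]] := not_separated r_gt0 s_lt nsep.
have [a0 pa0 qa0] := separatedP _ _ _ sep_pq.
(* A neighbour of [a'] outside [p] and [q] can be traded for [r] harmlessly;
   what remains is the case where [X] is contained in [{p, q}]. *)
pose X := link H a' :\: link H a.
have X_gt0 : 0 < #|X|.
  rewrite -ltnS; apply: leq_trans (link_diff (U := [set r; s]) bal _).
    by rewrite cards2 nrs.
  by rewrite subUset !sub1set !in_setD ra sa ra' sa'.
have X_gt1 z : z \notin [:: r; s] -> z \in link H a -> z \notin link H a' -> 1 < #|X|.
  rewrite mem_seq2 negb_or => /andP[zr zs] za za'; rewrite -ltnS.
  apply: leq_trans (link_diff (U := z |: [set r; s]) bal _).
    by rewrite cardsU1 cards2 nrs !inE negb_or zr zs.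
  by rewrite !subUset !sub1set !in_setD ra sa ra' sa' za za'.
have swap_r x : x \in X -> x \notin [:: p; q] \/ a0 \notin [:: a; a'] ->
  exists H', [/\ connect (@switch A B C) H H', deg_A H' =1 deg_A H,
    codeg H' =1 codeg H & separated H' p q && separated H' r s].
  rewrite in_setD => /andP[xa xa'] fixed.
  have [H' [sw eqA eqBC lnk]] := link_switch ra ra' xa' xa.
  exists H'; split=> //; first exact: connect1.
  have fix_a0 z : z \in [:: p; q] ->
      (if (z == r) || (z == x) then tperm a a' a0 else a0) = a0.
    case: fixed => [xpq | ]; last first.
      by rewrite !inE negb_or => /andP[? ?]; rewrite tpermD ?if_same // eq_sym.
    move=> zpq; rewrite eq_sym (negPf (memPn xpq z zpq)) orbF.
    move: zpq; rewrite mem_seq2 => /orP[] /eqP->;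
      by rewrite eq_sym ?(negPf npr) ?(negPf nqr).
  apply/andP; split; apply/separatedP; [exists a0 | exists a'].
  - by rewrite lnk fix_a0 ?mem_seq2 ?eqxx.
  - by rewrite lnk fix_a0 ?mem_seq2 ?eqxx ?orbT.
  - by rewrite lnk eqxx tpermR.
  - by rewrite lnk eq_sym (negPf nrs) (negPf (memPn xa _ sa)).
have [/exists_inP[x xX xpq] | /exists_inPn Xpq] :=
  boolP [exists x in X, x \notin [:: p; q]].
  by apply: (swap_r x) => //; left.
have XE x : x \in X -> (x == p) || (x == q) by move=> /Xpq; rewrite negbK !inE.
have X_pq : 1 < #|X| -> p \in X /\ q \in X.
  move=> X2; have subX : X \subset [set p; q] by apply/subsetP => x /XE; rewrite !inE.
  have : X == [set p; q] by rewrite eqEcard subX cards2 npq.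
  by move=> /eqP->; rewrite !inE !eqxx orbT.
have nps' : p \notin [:: r; s] by rewrite !inE negb_or npr.
have nqs' : q \notin [:: r; s] by rewrite !inE negb_or nqr.
have [pX | npX] := boolP (p \in X).
  have := pX; rewrite in_setD => /andP[pa pa'].
  have na0 : a0 != a by apply: contraNneq pa => <-.
  have [qa' | qa'] := boolP (q \in link H a').
    apply: (swap_r p) => //; right; rewrite !inE negb_or na0.
    by apply: contraNneq qa0 => ->.
  have qa : q \notin link H a.
    apply/negP => qa; have [_] := X_pq (X_gt1 q nqs' qa qa').
    by rewrite in_setD (negPf qa') andbF.
  (* Here [a'] may be the only witness for [p] and [q]. Trading [s], rather than [r], for [p] makes
     [a] a witness for both pairs: it gains [p], loses [s], keeps [r] and still misses [q]. *)
  have [H' [sw eqA eqBC lnk]] := link_switch sa sa' pa' pa.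
  exists H'; split=> //; first exact: connect1.
  apply/andP; split; apply/separatedP; exists a; rewrite lnk ?eqxx ?orbT ?tpermL //.
    by rewrite (negPf nqs) eq_sym (negPf npq).
  by rewrite (negPf nrs) eq_sym (negPf npr).
have qX : q \in X.
  have /card_gt0P[x xX] := X_gt0.
  by move: (xX) (XE x xX) npX => + /orP[] /eqP Ex; rewrite Ex // => ->.
have := qX; rewrite in_setD => /andP[qa qa'].
have na0 : a0 != a' by apply: contraNneq qa0 => ->.
have [pa | pa] := boolP (p \in link H a); last first.
  apply: (swap_r q) => //; right; rewrite !inE negb_or na0 andbT.
  by apply: contraNneq pa => <-.
have pa' : p \in link H a'.
  by apply: contraNT npX => pa'; case: (X_pq (X_gt1 p nps' pa pa')).
(* Now [a] may be the only witness for [p] and [q]. Trading [r] for [q] makes [a'] a witness for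
   both pairs: it has [p], loses [q], gains [r] and still misses [s]. *)
have [H' [sw eqA eqBC lnk]] := link_switch ra ra' qa' qa.
exists H'; split=> //; first exact: connect1.
apply/andP; split; apply/separatedP; exists a'; rewrite lnk ?eqxx ?orbT ?tpermR //.
  by rewrite (negPf npr) (negPf npq).
by rewrite eq_sym (negPf nrs) eq_sym (negPf nqs).
Qed.

(** * Moves on the codegree matrix and connectivity *)

Lemma deg_B_codeg H H' : codeg H =1 codeg H' -> deg_B H =1 deg_B H'.
Proof. by move=> eqH b; rewrite !deg_B_sum; apply: eq_bigr. Qed.

Lemma deg_C_codeg H H' : codeg H =1 codeg H' -> deg_C H =1 deg_C H'.
Proof. by move=> eqH c; rewrite !deg_C_sum; apply: eq_bigr. Qed.

Lemma codeg_move H b1 b2 c1 c2 : balanced H -> b1 != b2 -> c1 != c2 ->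
    0 < codeg H (b1, c1) -> codeg H (b2, c1) < #|A| ->
    0 < codeg H (b2, c2) -> codeg H (b1, c2) < #|A| ->
  exists H', [/\ connect (@switch A B C) H H', deg_A H' =1 deg_A H,
    deg_B H' =1 deg_B H, deg_C H' =1 deg_C H
  & forall z, codeg H' z + ((b1, c1) == z) + ((b2, c2) == z)
            = codeg H z + ((b2, c1) == z) + ((b1, c2) == z)].
Proof.
move=> bal nb nc p_gt0 q_lt r_gt0 s_lt.
have [|H1 [con1 eqA1 eqBC1 sep1]] := separate1 bal p_gt0 q_lt.
  by rewrite xpair_eqE (negPf nb).
have bal1 : balanced H1 by move=> a a'; rewrite !eqA1.
have [|||H2 [con2 eqA2 eqBC2 /andP[]]] :=
  @separate2 H1 (b1, c1) (b2, c1) (b2, c2) (b1, c2) bal1 _ _ _ sep1.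
- by rewrite eqBC1.
- by rewrite eqBC1.
- rewrite /= !inE !xpair_eqE !eqxx (negPf nb) (negPf nc) [b2 == b1]eq_sym (negPf nb).
  by rewrite ?andbF ?andbT.
(* The vertices [a1] and [a2] may coincide; the switch in [B] is still legal. *)
move=> /existsP[a1 /andP[/= e1 f1]] /existsP[a2 /andP[/= e2 f2]].
have [H3 sw ex] := switch_by_exchange swap_B_inv e1 e2 f1 f2.
exists H3; split=> [|a|b|c|z].
- apply: connect_trans con1 (connect_trans con2 (connect1 _)).
  by rewrite /switch sw orbT.
- have /= := card_exchange (fun e => e.1.1 == a) ex.
  by rewrite -!/(deg_A _ a) eqA2 eqA1; lia.
- have /= := card_exchange (fun e => e.1.2 == b) ex.
  by rewrite -!/(deg_B _ b) (deg_B_codeg eqBC2) (deg_B_codeg eqBC1); lia.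
- have /= := card_exchange (fun e => e.2 == c) ex.
  by rewrite -!/(deg_C _ c) (deg_C_codeg eqBC2) (deg_C_codeg eqBC1); lia.
have /= := card_exchange (fun e => (e.1.2, e.2) == z) ex.
by rewrite -!/(codeg _ z) eqBC2 eqBC1.
Qed.

Lemma connect_balanced H1 H2 : balanced H1 ->
    deg_A H1 =1 deg_A H2 -> deg_B H1 =1 deg_B H2 -> deg_C H1 =1 deg_C H2 ->
  connect (@switch A B C) H1 H2.
Proof.
have [n] := ubnP (\sum_z (codeg H1 z - codeg H2 z)).
elim: n => // n IHn in H1 H2 *; rewrite ltnS => le_n bal1 eqA eqB eqC.
have bal2 : balanced H2 by move=> a a'; rewrite -!eqA.
have [eqBC | /forallPn[[b0 c0] neq0]] := boolP [forall z, codeg H1 z == codeg H2 z].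
  by apply: connect_codeg => // z; apply/eqP/(forallP eqBC).
have row b : \sum_c codeg H1 (b, c) = \sum_c codeg H2 (b, c).
  by rewrite -!deg_B_sum eqB.
have col c : \sum_b codeg H1 (b, c) = \sum_b codeg H2 (b, c).
  by rewrite -!deg_C_sum eqC.
have [b1 [b2 [c1 [c2 [lt1 lt2 lt3 le4]]]]] :=
  @alternating_path _ _ (fun b c => codeg H1 (b, c)) (fun b c => codeg H2 (b, c))
    _ _ row col neq0.
have nb : b1 != b2 by apply: contraTneq lt1 => ->; rewrite -leqNgt ltnW.
have nc : c1 != c2 by apply: contraTneq lt2 => ->; rewrite -leqNgt ltnW.
have npr : (b1, c1) != (b2, c2) by rewrite xpair_eqE (negPf nb).
have dist M' N' :=
  @exchange_dist _ (codeg H1) (codeg H2) M' N' _ _ _ _ npr lt1 lt2 lt3 le4.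
(* Only the fourth cell can obstruct the move on [H1], by being full. Then it is full in [H2] as
   well, and the opposite move on [H2] can take a unit from it. *)
have [s_lt | s_ge] := ltnP (codeg H1 (b1, c2)) #|A|.
  have [|||H' [con eqA' eqB' eqC' ex]] := codeg_move bal1 nb nc _ _ _ s_lt.
  - exact: leq_ltn_trans lt1.
  - exact: leq_trans lt2 (codeg_leq _ _).
  - exact: leq_ltn_trans lt3.
  apply: (connect_trans con); apply: IHn => [||a|b|c]; rewrite ?eqA' ?eqB' ?eqC' //.
    apply: leq_trans (dist (codeg H') (codeg H2) _) le_n => z.
    by rewrite -!(addnAC _ _ (codeg H2 z)) ![z == _]eq_sym ex.
  by move=> a a'; rewrite !eqA'.
have nb' : b2 != b1 by rewrite eq_sym.
have [||||H' [con eqA' eqB' eqC' ex]] := codeg_move bal2 nb' nc.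
- exact: leq_ltn_trans lt2.
- exact: leq_trans lt1 (codeg_leq _ _).
(* A full cell is nonzero because [A] is nonempty, as the positive codegree of [(b1, c1)] in [H1]
   shows. *)
- apply: leq_trans le4; apply: leq_trans s_ge; apply: leq_trans (codeg_leq H1 (b1, c1)).
  exact: leq_ltn_trans lt1.
- exact: leq_trans lt3 (codeg_leq _ _).
apply: (@connect_trans _ _ H'); last by rewrite (sym_connect_sym switch_sym).
apply: IHn => // [|a|b|c]; rewrite ?eqA' ?eqB' ?eqC' //.
apply: leq_trans (dist (codeg H1) (codeg H') _) le_n => z.
by rewrite -!addnA; congr addn; rewrite !addnA ![z == _]eq_sym ex.
Qed.

Lemma almost_regular_balanced D H :
  third_almost_regular D -> realization D H -> balanced H.
Proof.
move=> [k regD] [degA _ _] a a'; rewrite !degA.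
by have := regD a; have := regD a'; lia.
Qed.

End Switches.

Theorem theorem13 (A B C : finType) (D : degree_sequence A B C)
    (H1 H2 : hypergraph A B C) :
  third_almost_regular D ->
  realization D H1 -> realization D H2 ->
  exists s : seq (hypergraph A B C),
    path (@switch A B C) H1 s /\ last H1 s = H2.
Proof.
move=> regD real1; have bal := almost_regular_balanced regD real1.
move: real1 => [eqA1 eqB1 eqC1] [eqA2 eqB2 eqC2].
have /connectP[s sw ->] : connect (@switch A B C) H1 H2.
  by apply: connect_balanced => // x; rewrite ?eqA1 ?eqA2 ?eqB1 ?eqB2 ?eqC1 ?eqC2.
by exists s.
Qed.
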